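(* Let $n\ge2$, let $f:[0,1]^n\to X$ be a homeomorphism onto a metric space $X$, and let $E\subset[0,1]^n$. If $\dim_{\mathrm H}f(E)<1$, then $$\dim_{\mathrm H}([0,1]^n\setminus E)\ge n-1.$$
   Context: $[0,1]^n$ carries the Euclidean metric. $\dim_{\mathrm H}$ denotes Hausdorff dimension with respect to the relevant metric (the Euclidean metric on $[0,1]^n$, the metric of $X$ on $X$). *)

(* Defs.v *)
From HB Require Import structures.
From mathcomp Require Import all_boot all_order all_algebra.
From mathcomp Require Import all_classical all_reals all_analysis.
From mathcomp Require Import ring lra.

Set Implicit Arguments.
Unset Strict Implicit.
Unset Printing Implicit Defensive.
Import Order.TTheory GRing.Theory Num.Theory.
Local Open Scope classical_set_scope.
Local Open Scope ring_scope.

(* The library puts the sup norm on 'rV[R]_n; this alias carries the Euclidean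
   metric, and the topology that it generates, instead. *)
Definition euclidean (R : realType) (n : nat) : Type := 'rV[R]_n.

HB.instance Definition _ (R : realType) (n : nat) :=
  Choice.copy (euclidean R n) 'rV[R]_n.

Definition euclidean_dist (R : realType) (n : nat) (x y : euclidean R n) : R :=
  Num.sqrt (\sum_(i < n) (x ord0 i - y ord0 i) ^+ 2).

Section euclidean_metric.
Context {R : realType} {n : nat}.
Implicit Types x y z : euclidean R n.

Let dist_xx x : euclidean_dist x x = 0.
Proof.
by rewrite /euclidean_dist big1 ?sqrtr0 // => i _; rewrite subrr expr0n.
Qed.

Let dist_eq0 x y : euclidean_dist x y = 0 -> x = y.
Proof.
move/eqP; rewrite sqrtr_eq0 => le0; apply/rowP => i; apply/eqP.
have sq_ge0 (j : 'I_n) : true -> 0 <= (x ord0 j - y ord0 j) ^+ 2.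
  by move=> _; exact: sqr_ge0.
have /eqP/(psumr_eq0P sq_ge0)/(_ i isT)/eqP :
    \sum_(i < n) (x ord0 i - y ord0 i) ^+ 2 == 0.
  by rewrite eq_le le0 sumr_ge0.
by rewrite sqrf_eq0 subr_eq0.
Qed.

Let dist_sym x y : euclidean_dist x y = euclidean_dist y x.
Proof.
by rewrite /euclidean_dist; congr Num.sqrt; apply: eq_bigr => i _; rewrite -sqrrN opprB.
Qed.

Let cauchy_schwarz (a b : 'I_n -> R) :
  (\sum_i a i * b i) ^+ 2 <= (\sum_i a i ^+ 2) * (\sum_i b i ^+ 2).
Proof.
have : 0 <= \sum_i \sum_j (a i * b j - a j * b i) ^+ 2.
  by apply: sumr_ge0 => i _; apply: sumr_ge0 => j _; exact: sqr_ge0.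
have -> : \sum_i \sum_j (a i * b j - a j * b i) ^+ 2 =
    ((\sum_i a i ^+ 2) * (\sum_i b i ^+ 2) - (\sum_i a i * b i) ^+ 2) *+ 2.
  have sumM (f g : 'I_n -> R) :
      (\sum_i f i) * (\sum_i g i) = \sum_i \sum_j f i * g j.
    by rewrite mulr_suml; apply: eq_bigr => i _; rewrite mulr_sumr.
  set A := \sum_i a i ^+ 2; set B := \sum_i b i ^+ 2; set C := \sum_i a i * b i.
  have -> : (A * B - C ^+ 2) *+ 2 = A * B + B * A - (C * C + C * C) by ring.
  rewrite !sumM -!big_split -sumrB; apply: eq_bigr => i _ /=.
  rewrite -!big_split -sumrB; apply: eq_bigr => j _ /=.
  by ring.
by rewrite pmulrn_lge0 // subr_ge0.
Qed.

Let dist_triangle y x z :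
  euclidean_dist x z <= euclidean_dist x y + euclidean_dist y z.
Proof.
rewrite /euclidean_dist.
set a := fun i : 'I_n => x ord0 i - y ord0 i.
set b := fun i : 'I_n => y ord0 i - z ord0 i.
have A0 : 0 <= \sum_i a i ^+ 2 by apply: sumr_ge0 => i _; exact: sqr_ge0.
have B0 : 0 <= \sum_i b i ^+ 2 by apply: sumr_ge0 => i _; exact: sqr_ge0.
have -> : \sum_(i < n) (x ord0 i - z ord0 i) ^+ 2 =
    \sum_i a i ^+ 2 + (\sum_i a i * b i) *+ 2 + \sum_i b i ^+ 2.
  rewrite -sumrMnl -!big_split; apply: eq_bigr => i _ /=.
  by rewrite /a /b; ring.
rewrite -[leRHS]ger0_norm ?addr_ge0 ?sqrtr_ge0// -sqrtr_sqr ler_wsqrtr//.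
rewrite sqrrD !sqr_sqrtr// lerD2r lerD2l lerMn2r /= -sqrtrM//.
by rewrite (le_trans (ler_norm _))// -sqrtr_sqr ler_wsqrtr.
Qed.

HB.instance Definition _ := isMetric.Build R (euclidean R n)
  dist_xx dist_eq0 dist_sym dist_triangle.

End euclidean_metric.

Lemma euclidean_mdistE (R : realType) (n : nat) (x y : euclidean R n) :
  mdist x y = euclidean_dist x y.
Proof. by []. Qed.

Definition unit_cube (R : realType) (n : nat) : set (euclidean R n) :=
  [set x | forall i : 'I_n, 0 <= x ord0 i <= 1].
Arguments unit_cube : clear implicits.

(* f restricts to a homeomorphism of the subspace A of T onto U; the values of
   f outside A play no role. *)
Definition homeomorphism_onto (T U : topologicalType) (A : set T) (f : T -> U)
    : Prop :=
  {within A, continuous f} /\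
  exists g : U -> T, [/\ continuous g, (forall y, A (g y)),
    (forall x, A x -> g (f x) = x) & (forall y, f (g y) = y)].

Section hausdorff_dimension.
Context {R : realType} {T : metricType R}.
Implicit Types (A : set T) (s delta : R).
Local Open Scope ereal_scope.

(* 0 is adjoined so that the empty set has diameter 0 and not -oo. *)
Definition diameter A : \bar R :=
  ereal_sup (0 |` [set (mdist z.1 z.2)%:E | z in A `*` A]).

(* As 0 `^ 0 = 1, the empty set is treated apart: it counts for 0 even when
   s = 0, so that finite covers can be padded with empty sets. *)
Definition diameter_pow s A : \bar R :=
  if A == set0 then 0 else diameter A `^ s.

Definition fine_cover delta A : set (set T)^nat :=
  [set U | (forall i, diameter (U i) <= delta%:E) /\ A `<=` \bigcup_i U i].

Definition hausdorff_premeasure s delta A : \bar R :=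
  ereal_inf [set \sum_(0 <= i <oo) diameter_pow s (U i) | U in fine_cover delta A].

Definition hausdorff_measure s A : \bar R :=
  ereal_sup [set hausdorff_premeasure s delta A | delta in [set d : R | (0 < d)%R]].

(* The infimum of the empty set is +oo, and set0 has dimension 0. *)
Definition hausdorff_dim A : \bar R :=
  ereal_inf [set s%:E | s in [set s : R | (0 <= s)%R /\ hausdorff_measure s A = 0]].

End hausdorff_dimension.

(* Main.v *)
(* Fix a corner p of the cube and an adjacent corner q. The function
   d(f p, .) is 1-Lipschitz and f(E) is H^1-null, so some level r strictly
   between d(f p, f p) and d(f p, f q) is not attained on f(E). By continuity
   and the intermediate value theorem every segment parallel to pq and close
   enough to it meets the level set { x | d(f p, f x) = r }, which lies in the
   complement of E. Hence the projection of the complement of E along pq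
   contains an (n-1)-dimensional cube; since the projection is Lipschitz, the
   complement is not H^s-null for any s < n-1. *)
Require Import Defs.
From mathcomp Require Import all_boot all_order all_algebra.
From mathcomp Require Import all_classical all_reals all_analysis.
From mathcomp Require Import measurable_realfun lra.
Import Order.TTheory GRing.Theory Num.Theory numFieldNormedType.Exports.
Local Open Scope classical_set_scope.
Local Open Scope ring_scope.

(* The weights c make the induction work: fixing the last coordinate t turns c
   into c times the indicators of the last sides at t, and integrating over t
   turns these indicators into side lengths. *)
Lemma box_cover_mass (R : realType) (m : nat) (L : R) (c a : nat -> R)
    (b : nat -> nat -> R) :
  0 <= L -> (forall i, 0 <= c i) -> (forall i, 0 <= a i) ->
  (forall x : nat -> R, (forall j, (j < m)%N -> 0 <= x j <= L) ->
     (1 <= \sum_(0 <= i <oo)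
       (c i * \prod_(j < m) \1_(`[(b i j - a i)%R, (b i j + a i)%R]) (x j))%:E)%E) ->
  ((L ^+ m)%:E <= \sum_(0 <= i <oo) (c i * (2 * a i) ^+ m)%:E)%E.
Proof.
move=> L0 + a0; elim: m c => [|m IH] c c0 cov.
  rewrite expr0; apply: le_trans (cov (fun=> 0) _) _ => //.
  by apply: lee_nneseries => [i _ _|i _]; rewrite lee_fin big_ord0 ?expr0 mulr1.
set mu := @lebesgue_measure R.
set I := fun i => `[(b i m - a i)%R, (b i m + a i)%R]%classic : set (measurableTypeR R).
set D := `[0%R, L]%classic : set (measurableTypeR R).
have mD : measurable D by exact: measurable_itv.
have mI i : measurable (I i) by exact: measurable_itv.
pose w i := c i * (2 * a i) ^+ m.
have w0 i : 0 <= w i by rewrite mulr_ge0// exprn_ge0// mulr_ge0.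
have slice t : D t ->
    ((L ^+ m)%:E <= \sum_(0 <= i <oo) ((w i)%:E * (\1_(I i) t)%:E))%E.
  rewrite /D /= in_itv/= => Dt.
  have c'0 i : 0 <= c i * \1_(I i) t by rewrite mulr_ge0// indicE.
  apply: (le_trans (IH (fun i => c i * \1_(I i) t) c'0 _)); last first.
    apply: lee_nneseries => [i _ _|i _].
      by rewrite lee_fin mulr_ge0// exprn_ge0// mulr_ge0.
    by rewrite -EFinM lee_fin /w mulrAC.
  move=> x x01.
  have x'01 j : (j < m.+1)%N -> 0 <= (if j == m then t else x j) <= L.
    by rewrite ltnS leq_eqVlt; case: eqP => //= _; exact: x01.
  apply: (le_trans (cov _ x'01)).
  apply: lee_nneseries => [i _ _|i _]; first by rewrite lee_fin mulr_ge0 ?prodr_ge0.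
  rewrite lee_fin big_ord_recr /= eqxx -/(I i).
  under eq_bigr => j _ do rewrite ltn_eqF//.
  by rewrite mulrAC mulrA.
(* Only an upper bound: [D] may cut off part of [I i], whose full length is [2 * a i]. *)
have massI i : (\int[mu]_(t in D) ((w i)%:E * (\1_(I i) t)%:E) <=
    (c i * (2 * a i) ^+ m.+1)%:E)%E.
  rewrite ge0_integralZl_EFin//; last first.
    by apply/measurable_EFinP; apply: measurable_indic; exact: mI.
  rewrite (integral_indic _ mD (mI i)) exprSr mulrA [leRHS]EFinM -/(w i).
  rewrite lee_wpmul2l ?lee_fin//.
  apply: (@le_trans _ _ (mu (I i))).
    by apply: le_measure; rewrite ?inE//; exact: measurableI.
  rewrite /mu lebesgue_measure_itv/= lte_fin; case: ifPn => _.
    by rewrite -EFinD lee_fin; lra.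
  by rewrite lee_fin mulr_ge0.
(* Now [slice] is integrated over [D]: its left side gains the factor [L], and on the right Tonelli
   moves the integral inside the sum, where [massI] bounds each term. *)
have <- : (\int[mu]_(t in D) (cst (L ^+ m)%:E) t = (L ^+ m.+1)%:E)%E.
  have muD : mu D = L%:E.
    rewrite /mu lebesgue_measure_itv/= lte_fin sube0.
    by case: ltP => // L0'; congr EFin; apply/le_anti; rewrite L0 L0'.
  by rewrite (integral_cst _ mD) [X in (_ * X)%E]muD -EFinM exprSr.
have mw i : measurable_fun D (fun t => (w i)%:E * (\1_(I i) t)%:E)%E.
  apply: measurable_funeM; apply/measurable_EFinP.
  by apply: measurable_indic; exact: mI.
have wI0 i t : D t -> (0 <= (w i)%:E * (\1_(I i) t)%:E)%E.
  by move=> _; rewrite -EFinM lee_fin mulr_ge0// indicE.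
apply: (@le_trans _ _ (\int[mu]_(t in D)
    \sum_(0 <= i <oo) ((w i)%:E * (\1_(I i) t)%:E))%E).
  apply: ge0_le_integral => //.
  - by move=> t _; rewrite lee_fin exprn_ge0.
  - by apply: ge0_emeasurable_sum => // i t Dt _; exact: wI0.
rewrite integral_nneseries//.
apply: lee_nneseries => [i _ _|i _]; last exact: massI.
by apply: integral_ge0 => t Dt; exact: wI0.
Qed.

Lemma mdist_le_diameter (R : realType) (T : metricType R) (A : set T) (x y : T) :
  A x -> A y -> ((mdist x y)%:E <= diameter A)%E.
Proof. by move=> Ax Ay; apply: ereal_sup_ubound; right; exists (x, y). Qed.

Lemma diameter_ge0 (R : realType) (T : metricType R) (A : set T) :
  (0 <= diameter A)%E.
Proof. by apply: ereal_sup_ubound; left. Qed.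

Lemma null_fine_cover (R : realType) (T : metricType R) (s delta e : R)
    (A : set T) : hausdorff_measure s A = 0 -> 0 < delta -> 0 < e ->
  exists2 U, fine_cover delta A U &
    (\sum_(0 <= i <oo) diameter_pow s (U i) < e%:E)%E.
Proof.
move=> A0 delta0 e0.
have /ereal_inf_lt[_ [U Ucov <-] Ue] : (hausdorff_premeasure s delta A < e%:E)%E.
  apply: (@le_lt_trans _ _ 0%E); last by rewrite lte_fin.
  by rewrite -A0; apply: ereal_sup_ubound; exists delta.
by exists U.
Qed.

(** For diameters at most 1, the exponent [m >= s] gives the smaller power, so [A] has covers of
    arbitrarily small [m]-dimensional mass. Since the coordinates of [h] are 1-Lipschitz, each
    covering set lands in a cube of comparable size, and cubes of total volume below [L ^+ m] leave
    a point [t] of the cube of side [L] uncovered. It serves for the distance to [f p] with [m = 1]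
    and for the projection along [pq] with [m = n - 1]. *)
Lemma null_lipschitz_image (R : realType) (T : metricType R) (s : R) (m : nat)
    (A : set T) (h : T -> nat -> R) (L : R) :
  0 <= s <= m%:R -> 0 < L -> hausdorff_measure s A = 0 ->
  (forall x y j, (j < m)%N -> `|h x j - h y j| <= mdist x y) ->
  exists2 t : nat -> R, (forall j, (j < m)%N -> 0 <= t j <= L) &
    forall x, A x -> exists2 j, (j < m)%N & h x j != t j.
Proof.
move=> /andP[s0 sm] L0 A0 hlip; apply: contrapT => noT.
(* The cubes have sides twice the diameters, which costs a factor [2 ^+ m]; this [e] keeps their
   total volume below [L ^+ m]. *)
pose e := L ^+ m / 2 ^+ m.
have e0 : 0 < e by rewrite divr_gt0 ?exprn_gt0.
have [U [Udiam AU] Ue] := null_fine_cover _ _ _ _ _ _ A0 ltr01 e0.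
pose a i := fine (diameter (U i)).
have aE i : diameter (U i) = (a i)%:E.
  rewrite fineK// ge0_fin_numE ?diameter_ge0//.
  by rewrite (le_lt_trans (Udiam i)) ?ltry.
have a0 i : 0 <= a i by rewrite fine_ge0 ?diameter_ge0.
have a1 i : a i <= 1 by have := Udiam i; rewrite aE lee_fin.
(* Weight 0 on empty sets agrees with [diameter_pow]; it matters for [m = 0], where
   [(2 * a i) ^+ m = 1] even for empty sets. *)
pose c i : R := if U i == set0 then 0 else 1.
have c0 i : 0 <= c i by rewrite /c; case: ifP.
(* h maps U i into the cube of half-side a i centred at the image b i of one of
   its points. *)
pose b i j := if pselect (exists x, U i x) is left p then h (projT1 (cid p)) j else 0.
have term_ge0 (t : nat -> R) i :
    0 <= c i * \prod_(j < m) \1_(`[(b i j - a i)%R, (b i j + a i)%R]) (t j).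
  by rewrite mulr_ge0 ?prodr_ge0.
have : ((L ^+ m)%:E <= \sum_(0 <= i <oo) (c i * (2 * a i) ^+ m)%:E)%E.
  apply: (box_cover_mass _ _ _ _ _ b (ltW L0) c0 a0) => t t01.
  have [x Ax hx] : exists2 x, A x & forall j, (j < m)%N -> h x j = t j.
    apply: contrapT => nox; apply: noT; exists t => // x Ax.
    apply: contrapT => noj; apply: nox; exists x => // j jm.
    by apply/eqP; apply: contrapT => /negP hj; apply: noj; exists j.
  have [i _ Uix] := AU _ Ax.
  apply: (@le_trans _ _ (\sum_(0 <= k < i.+1)
     (c k * \prod_(j < m) \1_(`[(b k j - a k)%R, (b k j + a k)%R]) (t j))%:E)%E);
    last by apply: nneseries_lim_ge => k _ _; rewrite lee_fin.
  rewrite big_nat_recr//=; apply: lee_paddl.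
    by apply: sume_ge0 => k _; rewrite lee_fin.
  rewrite /c ifF; last by apply/negbTE/set0P; exists x.
  rewrite mul1r lee_fin big1// => j _.
  rewrite indicE mem_set//= in_itv/= -hx// /b.
  case: pselect => [p|/(_ (ex_intro _ x Uix))//].
  case: cid => y Uiy /=; have := hlip x y j (ltn_ord j).
  have := mdist_le_diameter _ _ _ _ _ Uix Uiy.
  rewrite aE lee_fin => xya /le_trans/(_ xya).
  by rewrite ler_norml => /andP[? ?]; apply/andP; split; lra.
apply/negP; rewrite -ltNge.
have -> : L ^+ m = 2 ^+ m * e by rewrite /e mulrC divfK// expf_neq0.
apply: (@le_lt_trans _ _ ((2 ^+ m)%:E * \sum_(0 <= i <oo) diameter_pow s (U i))%E);
  last by rewrite EFinM lte_pmul2l// lte_fin exprn_gt0.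
rewrite -nneseriesZl; last first.
  by move=> i _; rewrite /diameter_pow; case: ifP => // _; exact: poweR_ge0.
apply: lee_nneseries => [i _ _|i _].
  by rewrite lee_fin mulr_ge0 ?exprn_ge0 ?mulr_ge0.
rewrite /diameter_pow /c; case: ifP => _; first by rewrite mul0r mule0.
rewrite aE poweR_EFin -EFinM lee_fin mul1r exprMn ler_wpM2l ?exprn_ge0//.
(* At diameter 0 the power with exponent [m] vanishes unless [m = 0], which forces [s = 0] and
   equality. *)
rewrite -powR_mulrn//; have := a0 i; rewrite le_eqVlt => /predU1P[<-|ai0]; last first.
  by rewrite ger_powR// ai0 a1.
have [m0|m0] := eqVneq m 0%N; last by rewrite powR0 ?pnatr_eq0// powR_ge0.
by have -> : s = m%:R by apply/le_anti; rewrite sm m0 s0.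
Qed.

Lemma mdist_lipschitz (R : realType) (T : metricType R) (p x y : T) :
  `|mdist p x - mdist p y| <= mdist x y.
Proof.
have := metric_triangle p y x; have := metric_triangle p x y.
by rewrite (metric_sym y x) ler_norml => *; apply/andP; split; lra.
Qed.

Lemma within_continuous_mdist (R : realType) (T U : metricType R) (A : set T)
    (f : T -> U) (x : T) (e : R) :
  {within A, continuous f} -> A x -> 0 < e ->
  exists2 d, 0 < d & forall y, A y -> mdist x y < d -> mdist (f x) (f y) < e.
Proof.
move=> /subspace_continuousP fA Ax e0.
have /metricType_numDomainType.cvgrPdist_lt/(_ _ e0) := fA _ Ax.
rewrite near_withinE => /metricType_numDomainType.nbhs_mdistP[d /= d0 dP].
by exists d => // y Ay xyd; exact: dP.
Qed.

Lemma coord_le_mdist (R : realType) (n : nat) (x y : euclidean R n) (i : 'I_n) :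
  `|x ord0 i - y ord0 i| <= mdist x y.
Proof.
rewrite euclidean_mdistE /euclidean_dist -sqrtr_sqr ler_wsqrtr//.
by rewrite (bigD1 i)//= lerDl sumr_ge0// => j _; exact: sqr_ge0.
Qed.

(** The sharp constant is the square root of [n]; the cruder [n], from [n <= n ^ 2], is enough for
    continuity estimates. *)
Lemma mdist_le_coord (R : realType) (n : nat) (x y : euclidean R n) (e : R) :
  0 <= e -> (forall i, `|x ord0 i - y ord0 i| <= e) -> mdist x y <= n%:R * e.
Proof.
move=> e0 xye; rewrite euclidean_mdistE /euclidean_dist.
rewrite -[leRHS]ger0_norm ?mulr_ge0// -sqrtr_sqr ler_wsqrtr//.
apply: (@le_trans _ _ (\sum_(i < n) e ^+ 2)).
  apply: ler_sum => i _; rewrite -real_normK ?num_real// ler_sqr ?nnegrE//.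
rewrite sumr_const card_ord -[leLHS]mulr_natl exprMn ler_wpM2r ?sqr_ge0//.
by rewrite -natrX ler_nat -mulnn; case: n {x y xye} => // n; rewrite leq_pmulr.
Qed.

Theorem proposition5p5 (R : realType) (n : nat) (hn : (2 <= n)%N)
    (X : metricType R) (f : euclidean R n -> X)
    (hf : homeomorphism_onto (unit_cube R n) f)
    (E : set (euclidean R n)) (hE : E `<=` unit_cube R n)
    (hdim : (hausdorff_dim (f @` E) < 1)%E) :
  ((n%:R - 1)%:E <= hausdorff_dim (unit_cube R n `\` E))%E.
Proof.
have [fc [g [_ _ gf _]]] := hf.
case: n hn f hf E hE hdim fc g gf => [//|[//|k]] _ f _ E EQ hdim fc g gf.
set Q := unit_cube R k.+2.
rewrite leNgt; apply/negP => /ereal_inf_lt[_ [s [s0 A0] <-]].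
rewrite lte_fin -natr1 addrK => sk.
have /ereal_inf_lt[_ [s' [s'0 F0] <-]] := hdim; rewrite lte_fin => s'1.
pose p : euclidean R k.+2 := \row_j 0.
pose q : euclidean R k.+2 := \row_j (j == ord0)%:R.
have Qp : Q p by move=> j; rewrite mxE lexx ler01.
have Qq : Q q by move=> j; rewrite mxE; case: eqP; rewrite ?lexx ?ler01.
set d := mdist (f p) (f q).
have d0 : 0 < d.
  rewrite mdist_gt0; apply/eqP => /(congr1 g); rewrite !gf// => /rowP/(_ ord0).
  by rewrite !mxE eqxx => /eqP; rewrite eq_sym oner_eq0.
have d30 : 0 < d / 3 by rewrite divr_gt0.
(* Taking [r] in the middle third leaves a margin [d / 3] for moving away from [p] and from [q].
   Subtracting [d / 3] brings this third to the interval from 0 to [d / 3]. *)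
have [r r01 rE] : exists2 r, d / 3 <= r <= d / 3 + d / 3 &
    forall x, E x -> mdist (f p) (f x) != r.
  have [|y z j _|t t01 tE] :=
    @null_lipschitz_image _ _ s' 1 _ (fun y _ => mdist (f p) y - d / 3) _ _ d30 F0.
  - by rewrite s'0 ltW.
  - by rewrite opprB addrA subrK; exact: mdist_lipschitz.
  exists (t 0%N + d / 3); last first.
    move=> x Ex; have [[|//] _] := tE (f x) (imageP f Ex).
    by rewrite subr_eq.
  by have /andP[? ?] := t01 0%N isT; apply/andP; split; lra.
have [d1 d10 fp] := within_continuous_mdist _ _ _ _ _ _ _ fc Qp d30.
have [d2 d20 fq] := within_continuous_mdist _ _ _ _ _ _ _ fc Qq d30.
(* The bound 1 keeps the shifted segment in the cube; dividing by [k.+3] rather than by the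
   dimension [k.+2] makes the estimate [eta_near] strict. *)
pose eta := Num.min 1 (Num.min d1 d2 / k.+3%:R).
have eta0 : 0 < eta by rewrite lt_min ltr01 divr_gt0// lt_min d10.
have eta_near (x y : euclidean R k.+2) :
    (forall i, `|x ord0 i - y ord0 i| <= eta) -> mdist x y < Num.min d1 d2.
  move=> /(mdist_le_coord _ _ _ _ _ (ltW eta0))/le_lt_trans; apply.
  apply: (@lt_le_trans _ _ (k.+3%:R * eta)); first by rewrite ltr_pM2r// ltr_nat.
  by rewrite mulrC -ler_pdivlMr// ge_min lexx orbT.
(* The projection forgets coordinate 0, the direction of [pq]; if the complement of [E] were null,
   its projection would miss a point [t] of the small cube. *)
have [||t t01 tA] := @null_lipschitz_image _ _ s k.+1 _
    (fun (x : euclidean R k.+2) j => x ord0 (inord j.+1)) _ _ eta0 A0.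
- by rewrite s0 ltW.
- by move=> x y j _; exact: coord_le_mdist.
(* Clamping makes the path gam below continuous on the whole line. *)
pose clamp (u : R) : R := Num.max 0 (Num.min 1 u).
have clamp01 u : 0 <= clamp u <= 1.
  by rewrite le_max lexx ge_max ler01 ge_min lexx.
have clamp_lip u v : `|clamp u - clamp v| <= `|u - v|.
  have := ler_norm (u - v); have := ler_norm (v - u); rewrite (distrC v u) ler_norml.
  move: `|u - v| => e; rewrite /clamp.
  case: (leP 1 u) => ?; case: (leP 1 v) => ?;
    case: (leP 0 u) => ?; case: (leP 0 v) => ?; rewrite ?(max_idPr ler01) => *; apply/andP; split; lra.
(* The segment parallel to [pq] above [t]; [i.-1] undoes the index shift of the projection. *)
pose gam u : euclidean R k.+2 := \row_i (if i == ord0 then clamp u else t i.-1).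
have t_small (i : 'I_k.+2) : i != ord0 -> 0 <= t i.-1 <= eta.
  by move=> i0; apply: t01; case: i i0 => [[|i] ilt].
have Qgam u : Q (gam u).
  move=> i; rewrite mxE; case: ifPn => // /t_small/andP[-> ti].
  by rewrite (le_trans ti)// ge_min lexx.
pose F u := mdist (f p) (f (gam u)).
have Fc : continuous F.
  move=> u; apply/(@cvgrPdist_lt _ R) => e e0.
  have [de de0 fe] := within_continuous_mdist _ _ _ _ _ _ _ fc (Qgam u) e0.
  near=> v.
  apply: (@le_lt_trans _ _ (mdist (f (gam u)) (f (gam v)))).
    exact: mdist_lipschitz.
  apply: fe; first exact: Qgam.
  apply: (@le_lt_trans _ _ (k.+2%:R * `|u - v|)).
    apply: mdist_le_coord => // i; rewrite !mxE; case: ifP => // _.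
    by rewrite subrr normr0.
  rewrite mulrC -ltr_pdivlMr//.
  near: v; apply: cvgr_dist_lt; [exact: cvg_id|by rewrite divr_gt0].
(* The ends of the segment are close to [p] and [q], so [F] takes values on both sides of [r]. *)
have F0r : F 0 < d / 3.
  apply: fp; first exact: Qgam.
  apply: (@lt_le_trans _ _ (Num.min d1 d2)); last by rewrite ge_min lexx.
  apply: eta_near => i; rewrite !mxE sub0r normrN; case: ifPn => [_|/t_small/andP[ti0 ti]].
    by rewrite /clamp (min_idPr ler01) maxxx normr0 ltW.
  by rewrite ger0_norm.
have F1r : d / 3 + d / 3 < F 1.
  have : mdist (f q) (f (gam 1)) < d / 3.
    apply: fq; first exact: Qgam.
    apply: (@lt_le_trans _ _ (Num.min d1 d2)); last by rewrite ge_min lexx orbT.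
    apply: eta_near => i; rewrite !mxE; case: ifPn => [_|/t_small/andP[ti0 ti]].
      by rewrite /clamp minxx (max_idPr ler01) subrr normr0 ltW.
    by rewrite sub0r normrN ger0_norm.
  have := metric_triangle (f p) (f (gam 1)) (f q).
  by rewrite /F (metric_sym (f (gam 1))) -/d; lra.
have [c _ Fcr] : exists2 c, c \in `[0, 1] & F c = r.
  apply: IVT => //; first exact: continuous_subspaceT.
  have /andP[r1 r2] := r01; apply/andP; split; [rewrite ge_min|rewrite le_max].
    by rewrite (ltW (lt_le_trans F0r r1)).
  by rewrite (ltW (le_lt_trans r2 F1r)) orbT.
(* The point [gam c] lies on level [r], hence outside [E], yet it projects to the missed point
   [t]. *)
have [|j jk] := tA (gam c).
  by split => // /rE; rewrite -/(F c) Fcr eqxx.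
rewrite mxE /= ifF ?inordK ?ltnS// ?eqxx//.
by rewrite -val_eqE/= inordK.
Unshelve. all: by end_near. Qed.
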